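(* Let $\zeta\in\mathbb{C}$ be a root of unity of order $d\ge2$ and let $l,s\in\mathbb{N}$ be such that $l\ge d+1$ and $s$ is odd. Write $l=qd+r$, where $q\ge1$, $r\in\{1,\ldots,d\}$, and put $$z_{d,l}=2^r\,\frac{2^{qd}-1}{2^d-1}-\begin{cases}2&\text{if }r<d,\\1&\text{if }r=d.\end{cases}$$ Then for $i=-z_{d,l},\ldots,z_{d,l}+1$ we have $$\mathcal{H}(2^ls+i,2\zeta)=0.$$ In particular, $\mathcal{H}(n,-2)=0$ for every integer $n\ge1$ that is not of the form $n_k-1$, $n_k$ or $n_k+1$ for some $k\in\mathbb{N}$, where $n_k=\lceil2^{k+2}/3\rceil$.
   Context: $\mathbb{N}=\{0,1,2,\ldots\}$. For $n\in\mathbb{N}$ with binary expansion $n=\sum_{j=0}^l\varepsilon_j2^j$, $\varepsilon_j\in\{0,1\}$, put $S(n,t)=\sum_{j=0}^l\varepsilon_jt^j$. For $n\ge1$ let $\mathcal{H}(n,t)=\det[S(i+j,t)]_{0\le i,j<n}$, a polynomial in $t$. *)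

(* Defs.v *)
From HB Require Import structures.
From mathcomp Require Import all_boot all_order all_algebra.
From mathcomp Require Import archimedean.
From mathcomp Require Import reals.
From mathcomp Require Import complex.
Set Implicit Arguments.
Unset Strict Implicit.
Unset Printing Implicit Defensive.
Import Order.TTheory GRing.Theory Num.Theory.
Local Open Scope ring_scope.

(* The coefficient of t^j is the binary digit eps_j of n, the parity of
   n %/ 2 ^ j.  All digits with j >= n are 0 because n < 2 ^ n. *)
Definition digit_poly (A : comNzRingType) (n : nat) : {poly A} :=
  \poly_(j < n) (odd (n %/ 2 ^ j))%:R.

Definition hankel_det (A : comNzRingType) (n : nat) : {poly A} :=
  \det (\matrix_(i < n, j < n) digit_poly A (i + j)).

(* z_{d,l} for l = q * d + r with 1 <= q and 1 <= r <= d.  In that range the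
   division is exact and none of the subtractions is truncated. *)
Definition zdl (d q r : nat) : nat :=
  (2 ^ r * ((2 ^ (q * d) - 1) %/ (2 ^ d - 1)) - (if r < d then 2 else 1))%N.

Definition nk (k : nat) : int := Num.ceil ((2 ^+ (k + 2) / 3) : rat).

(* Main.v *)
Require Import Defs.
From HB Require Import structures.
From mathcomp Require Import all_boot all_order all_algebra.
From mathcomp Require Import archimedean.
From mathcomp Require Import reals.
From mathcomp Require Import complex.
From mathcomp Require Import zify ring lra.
Import Order.TTheory GRing.Theory Num.Theory.
Local Open Scope ring_scope.

(**
A Hankel determinant of size n vanishes as soon as some nonzero polynomial Q of
degree less than n satisfies L(x^i Q) = 0 for all i < n, where L is the linear
functional sending x^j to the j-th term of the sequence: the coefficients of Q
then form a kernel vector (det_hankel_eq0).  So a single Q produces a whole gap,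
namely all n with deg Q < n up to the first i where L(x^i Q) is nonzero.

To find Q for the digit sums, read a sequence a as the series
sum_n a(n) x^(-n-1) modulo polynomials.  With the differences
d(n) = S(n+1) - S(n), the digit sums are represented by D / (x - 1), where D is
the series of d and
  D(x) = sum_k t^k / (x^(2^k) + 1),    D(x) = 1 / (x + 1) + t D(x^2).
Fix l and cut the sum at k = l; the tail is t^l D(x^(2^l)).  From
  D(y) = 1 / (y - 1) + C(y^2),
where C is the series of c = t d - 2, and from the telescoping identity
  2^l / (x^(2^l) - 1) = 1 / (x - 1) - sum_(k < l) 2^k / (x^(2^k) + 1),
one gets, for t = 2 z, the decomposition (digit_diff_split)
  D = z^l / (x - 1) + sum_(k < l) 2^k (z^k - z^l) / (x^(2^k) + 1)
      + t^l C(x^(2^(l+1))).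
The terms with z^k = z^l have disappeared.  Hence (x - 1) P, with P the product
of the factors x^(2^k) + 1 over k < l with z^k <> z^l, clears every denominator
of the first two parts, and its degree is 2^l - e instead of 2^l, where e is the
sum of the 2^k with z^k = z^l.

Only the last part remains.  It is a series in x^(2^(l+1)), so it is
approximated by w(x^(2^(l+1))), where w is a nonzero polynomial of degree at
most m whose product with C has m vanishing coefficients; such a w exists by
counting unknowns.  That C(y^2) is even is what makes the odd multiple
s = 2 m + 1 of 2^l appear.  Taking
  Q = (x - 1)^2 P w(x^(2^(l+1)))
and comparing degrees yields H(n, 2 z) = 0 for
2^l s - e + 2 <= n <= 2^l s + e - 1 (hankel_det_gap).

If z is a primitive d-th root of unity, z^k = z^l means k = l modulo d, and
e = z_{d,l} + 2 by a geometric sum.  For z = -1 and s = 1 the gap for l starts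
at n_{l-1} + 2 and ends at n_l - 2 (it may be empty), so that the gaps for
l >= 1 leave out only n_k - 1, n_k and n_k + 1.
*)

(** * Moment functionals of a sequence *)

Section Moment.
Variable A : comNzRingType.
Implicit Types (a b : nat -> A) (p q : {poly A}).

(** In terms of the series sum_n a(n) x^(-n-1) this is the coefficient of x^(-1)
in the product with p; that all moment a (x^i p) vanish means that p turns the
series of a into a polynomial. *)
Definition moment a p : A := \sum_(j < size p) p`_j * a j.

Lemma moment_wide a p n : (size p <= n)%N ->
  moment a p = \sum_(j < n) p`_j * a j.
Proof.
move=> le_pn; rewrite /moment (big_ord_widen n (fun j => p`_j * a j)) //.
rewrite big_mkcond; apply: eq_bigr => j _ /=; case: ltnP => // le_pj.
by rewrite nth_default // mul0r.
Qed.

Lemma moment_is_scalar a : scalar (moment a).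
Proof.
move=> c p q; pose n := maxn (size (c *: p + q)) (maxn (size p) (size q)).
have [h1 [h2 h3]] : (size (c *: p + q)%R <= n /\ size p <= n /\ size q <= n)%N.
  by rewrite !leq_max !leqnn !orbT.
rewrite !(moment_wide a _ n) // mulr_sumr -big_split /=.
by apply: eq_bigr => j _; rewrite coefD coefZ mulrDl mulrA.
Qed.

HB.instance Definition _ a :=
  GRing.isLinear.Build A {poly A} A *%R (moment a) (moment_is_scalar a).

Lemma momentXn a n : moment a 'X^n = a n.
Proof.
rewrite /moment size_polyXn big_ord_recr big1 /= => [|j _].
  by rewrite coefXn eqxx mul1r add0r.
by rewrite coefXn ltn_eqF ?mul0r.
Qed.

Lemma moment_mull a p q :
  moment a (p * q) = \sum_(i < size p) p`_i * moment a ('X^i * q).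
Proof.
rewrite -{1}[p]coefK poly_def mulr_suml linear_sum.
by apply: eq_bigr => i _; rewrite -scalerAl linearZ.
Qed.

(** By linearity in p, annihilation only has to be tested on monomials, and only
on those of degree at most the degree of p. *)
Lemma moment_mull_eq0 a p q :
  (forall i, (i < size p)%N -> moment a ('X^i * q) = 0) ->
  moment a (p * q) = 0.
Proof. by move=> aq0; rewrite moment_mull big1 // => i _; rewrite aq0 ?mulr0. Qed.

Lemma moment_mulXn a p i :
  moment a ('X^i * p) = \sum_(j < size p) p`_j * a (i + j)%N.
Proof.
rewrite mulrC moment_mull; apply: eq_bigr => j _.
by rewrite -exprD momentXn addnC.
Qed.

Lemma eq_moment a b p : a =1 b -> moment a p = moment b p.
Proof. by move=> ab; apply: eq_bigr => j _; rewrite ab. Qed.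

Lemma momentD a b p :
  moment (fun n => a n + b n) p = moment a p + moment b p.
Proof. by rewrite -big_split; apply: eq_bigr => j _; rewrite mulrDr. Qed.

Lemma momentZ c a p : moment (fun n => c * a n) p = c * moment a p.
Proof. by rewrite mulr_sumr; apply: eq_bigr => j _; rewrite mulrCA. Qed.

Lemma moment_sum m (a : 'I_m -> nat -> A) p :
  moment (fun n => \sum_(k < m) a k n) p = \sum_(k < m) moment (a k) p.
Proof. by rewrite exchange_big; apply: eq_bigr => j _; rewrite mulr_sumr. Qed.

(** The sequence whose series is a(x^m): in the exponent convention -n-1 the
term a(j) moves from place j to place m (j + 1) - 1. *)
Definition dilate (m : nat) a (n : nat) : A :=
  if (m %| n.+1)%N then a (n.+1 %/ m).-1 else 0.

Lemma dilate_mul m1 m2 a : (0 < m1)%N -> (0 < m2)%N ->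
  dilate (m1 * m2) a =1 dilate m1 (dilate m2 a).
Proof.
move=> m10 m20 n; rewrite {2}/dilate.
case: ifPn => [/dvdnP[j ej]|ndiv]; last first.
  rewrite /dilate ifN //; apply: contra ndiv; exact/dvdn_trans/dvdn_mulr.
have j0 : (0 < j)%N by case: j ej.
rewrite /dilate ej mulnK // prednK // (mulnC j) dvdn_pmul2l //.
by rewrite divnMl.
Qed.

(** Substituting x^m in both the series of a and the polynomial p commutes with
their product. *)
Lemma moment_dilate m a p i : (0 < m)%N ->
  moment (dilate m a) ('X^i * (p \Po 'X^m)) =
  dilate m (fun j => moment a ('X^j * p)) i.
Proof.
move=> m0; rewrite comp_polyE mulr_sumr linear_sum /=.
have coefE j : moment (dilate m a) ('X^i * (p`_j *: ('X^m) ^+ j)) =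
    p`_j * dilate m a (i + m * j)%N.
  by rewrite -scalerAr linearZ -exprM -exprD /= momentXn.
under eq_bigr => j _ do
  rewrite coefE /dilate -addSn dvdn_addl ?dvdn_mulr // divnDr ?dvdn_mulr // mulKn //.
rewrite /dilate; case: ifPn => [/dvdnP[k ek]|_]; last first.
  by rewrite big1 // => j _; rewrite mulr0.
rewrite moment_mulXn; apply: eq_bigr => j _.
by rewrite ek mulnK //; case: k ek.
Qed.

End Moment.

Arguments moment {A}.
Arguments dilate {A}.

(** * Hankel determinants and orthogonal polynomials *)

(** The coefficient vector of Q lies in the kernel of the Hankel matrix, since
its product with row i is moment a (x^i Q). *)
Lemma det_hankel_eq0 (A : idomainType) (a : nat -> A) (n : nat) (Q : {poly A}) :
  Q != 0 -> (size Q <= n)%N ->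
  (forall i, (i < n)%N -> moment a ('X^i * Q) = 0) ->
  \det (\matrix_(i < n, j < n) a (i + j)%N) = 0.
Proof.
move=> Q0 sQ aQ; apply/eqP/det0P; exists (poly_rV Q : 'rV_n).
  apply: contraNneq Q0 => e; rewrite -(poly_rV_K sQ) e.
  by rewrite linear0.
apply/rowP => i; rewrite !mxE -[RHS](aQ i (ltn_ord i)) moment_mulXn.
rewrite (big_ord_widen n (fun j => Q`_j * a (i + j)%N)) // [RHS]big_mkcond /=.
apply: eq_bigr => j _; rewrite !mxE addnC; case: ltnP => // sQj.
by rewrite nth_default // mul0r.
Qed.

(** There are m linear conditions for the m + 1 coefficients of w. *)
Lemma orthogonal_poly_exists (A : idomainType) (c : nat -> A) (m : nat) :
  exists w : {poly A}, [/\ w != 0, (size w <= m.+1)%N &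
    forall j, (j < m)%N -> moment c ('X^j * w) = 0].
Proof.
(* The column of zeros makes the system square, with a singular matrix. *)
pose C := \matrix_(i < m.+1, j < m.+1) if (j < m)%N then c (i + j)%N else 0.
have /det0P[v v0 vC] : \det C == 0.
  rewrite -det_tr (expand_det_row _ ord_max) big1 // => i _.
  by rewrite !mxE ltnn mul0r.
exists (rVpoly v); split=> [||j jm].
- by apply: contra v0 => /eqP e; rewrite -(rVpolyK v) e linear0.
- exact: size_poly.
have vCj : (v *m C) 0 (inord j) = 0 by rewrite vC mxE.
rewrite mulrC moment_mull -[RHS]vCj mxE.
have sv : (size (rVpoly v) <= m.+1)%N := size_poly _ _.
rewrite (big_ord_widen m.+1 (fun i => (rVpoly v)`_i * moment c ('X^i * 'X^j))) //.
rewrite big_mkcond /=; apply: eq_bigr => i _.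
rewrite mxE inordK ?jm ?(leqW jm) // -coef_rVpoly_ord -exprD momentXn.
by case: ltnP => // s; rewrite nth_default // mul0r.
Qed.

(** * Sums of binary digits and their differences *)

Section DigitSum.
Variables (A : comNzRingType) (t : A).

Definition digit_sum (n : nat) : A := (digit_poly A n).[t].

Lemma digit_sum_wide m n : (n <= m)%N ->
  digit_sum n = \sum_(j < m) (odd (n %/ 2 ^ j))%:R * t ^+ j.
Proof.
move=> nm; rewrite /digit_sum horner_poly.
rewrite (big_ord_widen m (fun j => (odd (n %/ 2 ^ j))%:R * t ^+ j)) //.
rewrite big_mkcond; apply: eq_bigr => j _ /=; case: ltnP => // nj.
have n2j : (n < 2 ^ j)%N by apply: leq_ltn_trans nj (ltn_expl _ _).
by rewrite (divn_small n2j) mul0r.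
Qed.

Lemma digit_sum_double (b : bool) n :
  digit_sum (b + n.*2) = b%:R + t * digit_sum n.
Proof.
rewrite (digit_sum_wide (b + n.*2).+1) // (digit_sum_wide (b + n.*2)); last by lia.
rewrite big_ord_recl divn1 expr0 mulr1 oddD odd_double addbF oddb mulr_sumr.
congr (_ + _); apply: eq_bigr => j _.
rewrite lift0 expnS divnMA divn2 half_bit_double exprS.
by rewrite mulrCA.
Qed.

Definition digit_diff (n : nat) : A := digit_sum n.+1 - digit_sum n.

Lemma digit_diff_even n : digit_diff n.*2 = 1.
Proof.
have := digit_sum_double true n; have := digit_sum_double false n.
by rewrite /digit_diff add0n add1n => -> ->; rewrite add0r addrK.
Qed.

Lemma digit_diff_odd n : digit_diff n.*2.+1 = t * digit_diff n - 1.
Proof.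
have := digit_sum_double true n; have := digit_sum_double false n.+1.
by rewrite /digit_diff add0n add1n doubleS => -> -> /=; ring.
Qed.

End DigitSum.

(** * Expansion of the digit sum series *)

Section DyadicExpansion.
Variable A : comNzRingType.
Implicit Types a b : nat -> A.

Lemma eq_dilate m a b : a =1 b -> dilate m a =1 dilate m b.
Proof. by move=> ab n; rewrite /dilate ab. Qed.

Lemma dilateD m a b n :
  dilate m (fun j => a j + b j) n = dilate m a n + dilate m b n.
Proof. by rewrite /dilate; case: ifP; rewrite ?addr0. Qed.

Lemma dilateZ m c a n : dilate m (fun j => c * a j) n = c * dilate m a n.
Proof. by rewrite /dilate; case: ifP; rewrite ?mulr0. Qed.

Lemma dilate1 a : dilate 1 a =1 a.
Proof. by move=> n; rewrite /dilate dvd1n divn1. Qed.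

Lemma dilate2_even a n : dilate 2 a n.*2 = 0.
Proof. by rewrite /dilate dvdn2 /= odd_double. Qed.

Lemma dilate2_odd a n : dilate 2 a n.*2.+1 = a n.
Proof. by rewrite /dilate -doubleS dvdn2 odd_double divn2 doubleK. Qed.

Lemma nat_parity_ind (P : nat -> Prop) :
  (forall n, P n.*2) -> (forall n, P n.*2.+1) -> forall n, P n.
Proof.
move=> Pe Po n; rewrite -[n]odd_double_half.
by case: (odd n); rewrite ?add0n ?add1n.
Qed.

(** The coefficients of 1 / (x + 1); dilate (2 ^ k) alternating thus represents
1 / (x^(2^k) + 1). *)
Definition alternating (n : nat) : A := (-1) ^+ n.

(** Iterating the functional equation a(y) = 1 / (y + 1) + x a(y^2) of the series
of a, with x a scalar.  It is used with x = t for the digit differences and with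
x = 2 for the constant sequence 1. *)
Lemma dyadic_expansion x a :
  (forall n, a n = alternating n + x * dilate 2 a n) ->
  forall l n, a n = \sum_(k < l) x ^+ k * dilate (2 ^ k) alternating n
                    + x ^+ l * dilate (2 ^ l) a n.
Proof.
move=> aE; elim=> [|l IHl] n.
  by rewrite big_ord0 add0r expr0 mul1r expn0 dilate1.
rewrite {}IHl big_ord_recr /= -addrA; congr (_ + _).
rewrite (eq_dilate _ _ _ aE) dilateD dilateZ mulrDr exprSr expnSr.
by rewrite dilate_mul ?expn_gt0 // mulrA.
Qed.

Lemma digit_diff_rec t n :
  digit_diff A t n = alternating n + t * dilate 2 (digit_diff A t) n.
Proof.
rewrite /alternating; elim/nat_parity_ind: n => n.
  by rewrite digit_diff_even dilate2_even -signr_odd odd_double mulr0 addr0.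
by rewrite digit_diff_odd dilate2_odd -signr_odd /= odd_double addrC.
Qed.

(** The partial fraction 1 / (x - 1) = 1 / (x + 1) + 2 / (x^2 - 1). *)
Lemma one_rec n : 1 = alternating n + 2 * dilate 2 (fun=> 1) n :> A.
Proof.
rewrite /alternating; elim/nat_parity_ind: n => n.
  by rewrite dilate2_even -signr_odd odd_double mulr0 addr0.
by rewrite dilate2_odd -signr_odd /= odd_double; ring.
Qed.

(** Adding 1 to an even number changes only the last digit, so digit_diff is 1 at
the even places.  Once the constant 1 is removed, only odd places remain, which
are those of a series in x^2. *)
Lemma digit_diff_tail t n :
  digit_diff A t n =
  1 + dilate 2 (fun j => t * digit_diff A t j - 2) n.
Proof.
elim/nat_parity_ind: n => n.
  by rewrite digit_diff_even dilate2_even addr0.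
by rewrite digit_diff_odd dilate2_odd; ring.
Qed.

(** Both expansions of length l have the same building blocks; subtracting z^l
times the one of the constant 1 from the one of digit_diff replaces the
coefficient 2^k z^k by 2^k (z^k - z^l), which vanishes when z^k = z^l. *)
Lemma digit_diff_split z l n (c := fun j => 2 * z * digit_diff A (2 * z) j - 2) :
  digit_diff A (2 * z) n =
  z ^+ l + \sum_(k < l) 2 ^+ k * (z ^+ k - z ^+ l) * dilate (2 ^ k) alternating n
  + (2 * z) ^+ l * dilate (2 ^ l.+1) c n.
Proof.
have dE := dyadic_expansion _ _ (digit_diff_rec (2 * z)) l n.
have oneE := dyadic_expansion _ _ one_rec l n.
rewrite {}dE (eq_dilate _ _ _ (digit_diff_tail _)) dilateD -/c.
rewrite expnSr dilate_mul ?expn_gt0 // mulrDr addrA; congr (_ + _).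
have zlE := congr1 ( *%R (z ^+ l)) oneE; rewrite mulr1 mulrDr mulr_sumr in zlE.
rewrite [X in _ = X + _]zlE addrAC -big_split /= mulrA -exprMn (mulrC z).
by congr (_ + _); apply: eq_bigr => k _; rewrite exprMn; ring.
Qed.

(** The series of a constant sequence is a multiple of 1 / (x - 1). *)
Lemma moment_const_kill x p : moment (fun=> x) (p * ('X - 1)) = 0 :> A.
Proof.
apply: moment_mull_eq0 => i _.
by rewrite mulrBr mulr1 -exprSr linearB /= !momentXn subrr.
Qed.

(** Through moment_dilate this reduces to k = 0, where consecutive terms of the
alternating sequence cancel. *)
Lemma moment_alternating_kill k p :
  moment (dilate (2 ^ k) alternating) (p * ('X^(2 ^ k) + 1)) = 0.
Proof.
have -> : 'X^(2 ^ k) + 1 = ('X + 1) \Po 'X^(2 ^ k) :> {poly A}.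
  by rewrite comp_polyD comp_polyX -polyC1 comp_polyC.
apply: moment_mull_eq0 => i _; rewrite moment_dilate ?expn_gt0 //.
rewrite /dilate; case: ifP => // _.
by rewrite mulrDr mulr1 -exprSr linearD /= !momentXn /alternating exprS; ring.
Qed.

Lemma moment_digit_sum t p :
  moment (digit_sum A t) (p * ('X - 1)) = moment (digit_diff A t) p.
Proof.
rewrite -[X in _ = moment _ X]mulr1 !moment_mull; apply: eq_bigr => i _.
by rewrite mulr1 mulrBr mulr1 -exprSr linearB /= !momentXn.
Qed.

End DyadicExpansion.

(** * The gap around an odd multiple of a power of two *)

Lemma sum_pow2 (l : nat) : ((\sum_(k < l) 2 ^ k).+1 = 2 ^ l)%N.
Proof.
elim: l => [|n IHn]; first by rewrite big_ord0.
by rewrite big_ord_recr /= -addSn IHn addnn -mul2n expnS.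
Qed.

Section Gap.
Variables (A : idomainType) (z : A) (l : nat).

Definition remaining_denominator : {poly A} :=
  \prod_(k < l | z ^+ k != z ^+ l) ('X^(2 ^ k) + 1).

Definition cancelled_degree : nat := (\sum_(k < l | (z ^+ k == z ^+ l)%R) 2 ^ k)%N.

Lemma remaining_denominator_size :
  remaining_denominator \is monic /\ (size remaining_denominator + cancelled_degree = 2 ^ l)%N.
Proof.
have [mon sz] : remaining_denominator \is monic /\
    size remaining_denominator = ((\sum_(k < l | (z ^+ k != z ^+ l)%R) 2 ^ k).+1)%N.
  apply: (big_ind2 (fun p s => p \is monic /\ size p = s.+1)).
  - by rewrite monic1 size_poly1.
  - move=> p1 s1 p2 s2 [m1 e1] [m2 e2]; rewrite monicMl // size_monicM ?monic_neq0 //.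
    by rewrite e1 e2 addnS.
  - move=> k _; rewrite -polyC1 monicXnaddC ?expn_gt0 //.
    by rewrite size_XnaddC ?expn_gt0.
split=> //; rewrite sz -sum_pow2.
rewrite [X in _ = X.+1](bigID (fun k : 'I_l => z ^+ k == z ^+ l)) /=.
by rewrite addSn addnC.
Qed.

(** In the expansion of digit_diff the constant part is annihilated by x - 1, and
a term 1 / (x^(2^k) + 1) has coefficient 0 or its denominator is one of the
factors of remaining_denominator.  Only the tail survives. *)
Lemma moment_digit_diff p (c := fun j => 2 * z * digit_diff A (2 * z) j - 2) :
  moment (digit_diff A (2 * z)) (p * remaining_denominator * ('X - 1)) =
  (2 * z) ^+ l * moment (dilate (2 ^ l.+1) c) (p * remaining_denominator * ('X - 1)).
Proof.
rewrite (eq_moment _ _ _ _ (fun n => digit_diff_split A z l n)).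
rewrite momentD momentZ momentD moment_const_kill add0r moment_sum.
rewrite big1 ?add0r // => k _; rewrite momentZ.
have [->|zkl] := eqVneq (z ^+ k) (z ^+ l); first by rewrite subrr mulr0 mul0r.
rewrite /remaining_denominator (bigD1 k) //=; set P := \prod_(_ < _ | _) _.
have -> : p * (('X^(2 ^ k) + 1) * P) * ('X - 1) =
          p * P * ('X - 1) * ('X^(2 ^ k) + 1) by ring.
by rewrite moment_alternating_kill mulr0.
Qed.

(** Let N = 2^l (2 m + 1) and let e be the cancelled degree.  The annihilating
polynomial has degree at most N - e + 1, and its moments against x^i vanish for
i < N + e - 1. *)
Lemma hankel_det_gap m n :
  (2 ^ l * m.*2.+1 + 2 <= n + cancelled_degree)%N ->
  (n < 2 ^ l * m.*2.+1 + cancelled_degree)%N ->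
  (hankel_det A n).[2 * z] = 0.
Proof.
move=> le_n lt_n.
have -> : (hankel_det A n).[2 * z] =
    \det (\matrix_(i < n, j < n) digit_sum A (2 * z) (i + j)%N).
  rewrite /hankel_det -horner_evalE -det_map_mx; congr (\det _).
  by apply/matrixP => i j; rewrite !mxE.
pose c j := 2 * z * digit_diff A (2 * z) j - 2.
have [w [w0 sw cw]] := orthogonal_poly_exists A c m.
pose W := w \Po 'X^(2 ^ l.+1).
have [Pmon Psize] := remaining_denominator_size.
have Dmon : 'X - 1 \is @monic A by rewrite -polyC1 monicXsubC.
have Dsize : size ('X - 1 : {poly A}) = 2 by rewrite -polyC1 size_XsubC.
(* One factor x - 1 turns digit sums into differences, the other one clears
   the pole of the constant part. *)
pose K := remaining_denominator * ('X - 1) * ('X - 1).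
have Kmon : K \is monic by rewrite !monicMl.
have W0 : W != 0.
  by rewrite comp_poly_eq0 // size_polyXn ltnS expn_gt0.
have Wsize : (size W <= (m * 2 ^ l.+1).+1)%N.
  apply: leq_trans (size_comp_poly_leq _ _) _.
  by rewrite size_polyXn ltnS leq_mul2r; apply/orP; right; lia.
have Bsize : size (remaining_denominator * ('X - 1)) = (size remaining_denominator).+1.
  by rewrite size_monicM ?monic_neq0 // Dsize addn2.
have Ksize : size K = (size remaining_denominator).+2.
  by rewrite size_monicM ?monic_neq0 ?monicMl // Bsize Dsize addn2.
have expE : (2 ^ l.+1 = 2 * 2 ^ l)%N by rewrite expnS.
apply: (@det_hankel_eq0 _ _ _ (K * W)).
- by rewrite mulf_neq0 // monic_neq0.
- by rewrite size_monicM ?Ksize //; nia.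
move=> i lt_in.
have -> : 'X^i * (K * W) = 'X^i * W * remaining_denominator * ('X - 1) * ('X - 1).
  by rewrite /K; ring.
rewrite moment_digit_sum moment_digit_diff -/c.
have -> : 'X^i * W * remaining_denominator * ('X - 1) =
          'X^i * (remaining_denominator * ('X - 1)) * W by ring.
rewrite moment_mull_eq0 ?mulr0 // => a lt_a.
(* Only the exponents a with a + 1 = 2^(l+1) j contribute; the degree bound
   forces j <= m, where w is orthogonal to x^(j-1). *)
rewrite moment_dilate ?expn_gt0 // /dilate; case: ifP => // /dvdnP[j ej].
rewrite ej mulnK ?expn_gt0 // cw //.
move: lt_a; rewrite size_monicM ?monic_neq0 ?monicXn ?monicMl // size_polyXn Bsize.
move=> lt_a; have : (j * 2 ^ l.+1 < m.+1 * 2 ^ l.+1)%N by nia.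
rewrite ltn_mul2r => /andP[_]; case: j ej => //.
Qed.

End Gap.

(** * The length of the gap for roots of unity *)

(** When r = d, the residue class of r also contains the exponent 0; this is the
extra term, and the reason for the case distinction in zdl. *)
Lemma sum_pow2_mod (d q r : nat) : (0 < r <= d)%N ->
  (\sum_(k < q * d + r | k == r %[mod d]) 2 ^ k =
   2 ^ r * (\sum_(j < q) (2 ^ d) ^ j) + (r == d))%N.
Proof.
move=> /andP[r0 rd]; rewrite -(big_mkord (fun k => k == r %[mod d]) (expn 2)).
elim: q => [|q IHq].
  rewrite mul0n add0n big_ord0 muln0 add0n big_ltn_cond // big_nat_cond big1.
    rewrite addn0 mod0n eq_sym; case: ltngtP rd => // [ltrd|->] _.
      by rewrite modn_small // gtn_eqF.
    by rewrite modnn.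
  move=> k /andP[/andP[k0 kr]]; rewrite modn_small; last exact: leq_trans rd.
  case: (ltngtP r d) rd => // [ltrd|->] _; last by rewrite modnn; case: k k0 {kr}.
  by rewrite modn_small // ltn_eqF.
have d0 : (0 < d)%N := leq_trans r0 rd.
rewrite (@big_cat_nat _ _ _ (q * d + r)) //=; last by rewrite leq_add2r leq_pmul2r.
rewrite {}IHq big_ord_recr /= mulnDr addnAC; congr (_ + _ + _)%N.
rewrite -{1}[(q * d + r)%N]add0n big_addn mulSn -addnA addnK.
rewrite big_ltn_cond // add0n modnMDl eqxx big_nat_cond big1 ?addn0.
  by rewrite -expnM mulnC expnD mulnC (mulnC d).
move=> i /andP[/andP[i0 id]]; rewrite addnA -[X in _ == X %[mod d]]add0n eqn_modDr.
by rewrite addnC modnMDl mod0n modn_small // gtn_eqF.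
Qed.

Lemma cancelled_degreeE (A : idomainType) (z : A) (d q r : nat) :
  d.-primitive_root z -> (0 < r <= d)%N ->
  cancelled_degree A z (q * d + r) =
  (2 ^ r * (\sum_(j < q) (2 ^ d) ^ j) + (r == d))%N.
Proof.
move=> prim_z rd; rewrite -sum_pow2_mod //; apply: eq_bigl => k.
by rewrite (eq_prim_root_expr prim_z) modnMDl.
Qed.

Lemma zdl_cancelled_degree (A : idomainType) (z : A) (d q r : nat) :
  d.-primitive_root z -> (1 <= q)%N -> (0 < r <= d)%N ->
  (zdl d q r + 2)%N = cancelled_degree A z (q * d + r).
Proof.
move=> prim_z q1 rd; rewrite (cancelled_degreeE _ _ _ _ _ prim_z rd) /zdl.
have d0 : (0 < 2 ^ d - 1)%N.
  by rewrite subn_gt0 -{1}(expn0 2) ltn_exp2l //; lia.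
have -> : (2 ^ (q * d) - 1 = (2 ^ d - 1) * \sum_(j < q) (2 ^ d) ^ j)%N.
  by rewrite mulnC expnM !subn1 predn_exp.
rewrite mulKn //; set s := (\sum_(j < q) _)%N.
have s0 : (0 < s)%N by rewrite /s; case: (q) q1 => // k _; rewrite big_ord_recl.
have r2 : (2 <= 2 ^ r)%N by case: (r) rd => // k _; rewrite expnS leq_pmulr ?expn_gt0.
have : (2 <= 2 ^ r * s)%N by nia.
by case: (ltngtP r d) rd => //=; lia.
Qed.

(** * The case of the parameter -2 *)

Lemma nkE (k : nat) : 3 * nk k = (2 ^ k.+2 + (~~ odd k).+1)%N%:Z.
Proof.
have [a aE] : exists a, (3 * a = 2 ^ k.+2 + (~~ odd k).+1)%N.
  elim: k => [|k [a aE]]; first by exists 2.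
  by exists (2 * a - ~~ odd k)%N; rewrite (expnS 2 k.+2) /=; move: aE; case: (odd k) => /=; lia.
rewrite -aE /nk (@ceil_def _ _ a%:Z) ?PoszM //.
have aQ : 3 * a%:R = 2 ^+ (k + 2) + (~~ odd k).+1%:R :> rat.
  by rewrite addn2 -natrX -natrD -aE natrM.
rewrite rmorphB /= -!pmulrn ltr_pdivlMr // ler_pdivrMr //.
by case: (odd k) aQ => /= aQ; lra.
Qed.

Lemma prim_root_N1 (A : idomainType) : (2 : A) != 0 -> 2.-primitive_root (-1 : A).
Proof.
move=> A2; have N11 : (-1 == 1 :> A) = false.
  by rewrite eq_sym -subr_eq0 opprK -mulr2n; apply/negbTE.
apply/andP; split=> //; apply/forallP => -[[|[|//]] lt_i] /=.
  by rewrite unity_rootE expr1 N11.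
by rewrite unity_rootE sqrrN expr1n !eqxx.
Qed.

(** The sum of the powers 4^j comes from (4^q - 1) / 3. *)
Lemma cancelled_degree_N1 (A : idomainType) k : (2 : A) != 0 -> (0 < k)%N ->
  (3 * cancelled_degree A (-1) k + (odd k).+1 = 2 ^ k)%N.
Proof.
move=> A2 k0.
have [q [r [-> r12]]] : exists q r, k = (q * 2 + r)%N /\ (0 < r <= 2)%N.
  by exists ((k.-1)./2), (2 - odd k)%N; lia.
rewrite (cancelled_degreeE _ _ _ _ _ (prim_root_N1 A A2) r12).
have := predn_exp (2 ^ 2) q; rewrite -expnM mulnC; set s := (\sum_(j < q) _)%N => sE.
have q0 : (0 < 2 ^ (q * 2))%N by rewrite expn_gt0.
rewrite oddD oddM andbF /= expnD.
by case: r r12 => [|[|[|]]] //= _; lia.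
Qed.

(** Take the least k with n <= n_k + 1.  Then n_{k-1} + 2 <= n <= n_k - 2, which
is exactly the gap around 2^k. *)
Lemma hankel_det_N2 (A : idomainType) (n : nat) : (2 : A) != 0 -> (1 <= n)%N ->
  ~ (exists k : nat,
       [\/ n%:Z = nk k - 1, n%:Z = nk k | n%:Z = nk k + 1]) ->
  (hankel_det A n).[-2] = 0.
Proof.
move=> A2 n1 not_near.
have nk_large : exists k, n%:Z <= nk k + 1.
  by exists n; have := nkE n; have := ltn_expl n (isT : (1 < 2)%N); rewrite !expnS; lia.
case: (ex_minnP nk_large) => k n_le k_min.
have n_le2 : n%:Z <= nk k - 2.
  have [h1 h2 h3] : [/\ n%:Z <> nk k - 1, n%:Z <> nk k & n%:Z <> nk k + 1].
    by split=> h; apply: not_near; exists k; [apply: Or31|apply: Or32|apply: Or33].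
  by lia.
have k0 : (0 < k)%N by case: (k) n_le2 => //; have := nkE 0; lia.
have n_ge : nk k.-1 + 2 <= n%:Z.
  have : ~~ (n%:Z <= nk k.-1 + 1) by apply/negP => /k_min; lia.
  by lia.
have := cancelled_degree_N1 A k A2 k0; have := hankel_det_gap A (-1) k 0 n.
rewrite mulrN1 double0 muln1; move: (cancelled_degree _ _ _) => e gap eE.
have nk1E := nkE k.-1; have nkkE := nkE k.
clear nk_large n_le k_min not_near.
case: k k0 n_le2 n_ge gap eE nk1E nkkE => [//|k _] n_le2 n_ge gap eE nk1E nkkE.
rewrite /= !expnS in eE n_ge nk1E nkkE gap.
by apply: gap; case: (odd k) eE nk1E nkkE => /=; lia.
Qed.

(* The index 2 ^ l * s + i is always positive, since zdl d q r < 2 ^ l, so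
   taking its absolute value only converts it from int to nat. *)
Theorem theorem5p4 (R : realType) :
  (forall (zeta : complex R) (d l s q r : nat),
     (2 <= d)%N -> d.-primitive_root zeta ->
     (d + 1 <= l)%N -> odd s ->
     l = (q * d + r)%N -> (1 <= q)%N -> (1 <= r <= d)%N ->
     forall i : int,
       - (zdl d q r)%:Z <= i <= (zdl d q r)%:Z + 1 ->
       (hankel_det (complex R) (absz ((2 ^ l * s)%N%:Z + i))).[2 * zeta] = 0)
  /\
  (forall n : nat, (1 <= n)%N ->
     ~ (exists k : nat,
          [\/ n%:Z = nk k - 1, n%:Z = nk k | n%:Z = nk k + 1]) ->
     (hankel_det (complex R) n).[-2] = 0).
Proof.
split=> [zeta d l s q r _ prim_zeta _ odd_s lE q1 rd i|n n1].
  have eE := zdl_cancelled_degree _ _ _ _ _ prim_zeta q1 rd; rewrite -lE in eE.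
  have [_ e_le] := remaining_denominator_size _ zeta l.
  have sE : s = s./2.*2.+1 by rewrite -[LHS]odd_double_half odd_s.
  have N_ge : (2 ^ l <= 2 ^ l * s)%N by rewrite leq_pmulr // sE.
  by move=> i_bounds; apply: (hankel_det_gap _ _ l s./2); rewrite -sE; lia.
by apply: hankel_det_N2 n1; rewrite pnatr_eq0.
Qed.
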